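(* Let $H$ be a Hilbert space, let $F\subset H$ be a closed subspace, and let $V\subset H$ be a finite dimensional subspace. If $F\cap V = \{0\}$, then there exists a constant $\gamma = \gamma (V, F)\in [0,1)$ such that for every $x\in V$ and every $y\in F$, $$|(x,y)| \le \gamma \|x\| \|y\|.$$
   Context: Subspaces are vector (linear) subspaces. $(x,y)$ denotes the inner product of $H$ (linear in the first argument and conjugate linear in the second), and $\|x\| = \sqrt{(x,x)}$. *)

(* Defs.v *)
From mathcomp Require Import all_boot all_order all_algebra.

Set Implicit Arguments.
Unset Strict Implicit.
Unset Printing Implicit Defensive.

Import GRing.Theory.
Local Open Scope ring_scope.

Definition finite_dimensional (K : fieldType) (U : lmodType K) (V : {pred U}) :
    Prop :=
  exists (n : nat) (v : 'I_n -> U),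
    forall x : U, x \in V <->
      exists c : 'I_n -> K, x = \sum_(i < n) c i *: v i.

(* Main.v *)
(* Closedness of [F] and [F `&` V = 0] give [M] with [|x| <= M |x + y|] for all
   [x] in [V] and [y] in [F], by induction on the number of generators of [V]:
   one generator [u] is moved from [V] to [F], and [F + C u] is again closed
   because [|a u + y| >= d |a|] with [d] the distance from [u] to [F].
   Minimising [|x + t y|^2] over the scalars [t] then turns
   [c |x|^2 <= |x + t y|^2] into [|(x, y)|^2 <= (1 - c) |x|^2 |y|^2]. *)

Require Import Defs.
From mathcomp Require Import all_boot all_order all_algebra complex.
From mathcomp Require Import all_classical all_reals all_analysis.

Import Order.TTheory GRing.Theory Num.Theory.
Import numFieldNormedType.Exports.
Local Open Scope classical_set_scope.
Local Open Scope ring_scope.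
Local Open Scope complex_scope.

Lemma dot_le_of_dist {C : numClosedFieldType} {U : lmodType C}
    (dot : {dot U for (Num.conj : C -> C)}) (c : C) (x y : U) :
  (forall t, c * dot x x <= dot (x + t *: y) (x + t *: y)) ->
  `|dot x y| ^+ 2 <= (1 - c) * dot x x * dot y y.
Proof.
move=> le_c; have [->|y0] := eqVneq y 0.
  by rewrite !linear0r normr0 expr0n /= ?mulr0.
have yy0 : 0 < dot y y by rewrite dnorm_gt0.
(* This [t] makes [x + t *: y] orthogonal to [y]; the squared norm then takes its least value
   [dot x x - q], with [q] the quotient named below. *)
have := le_c (- (dot x y / dot y y)); rewrite scaleNr dnormB dnormZ.
have -> : dot x ((dot x y / dot y y) *: y) = `|dot x y| ^+ 2 / dot y y.
  rewrite linearZr_LR/= rmorphM/= fmorphV/= (CrealP (gtr0_real yy0)).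
  by rewrite mulrAC -normCKC.
have qR : `|dot x y| ^+ 2 / dot y y \is Num.real.
  by rewrite ger0_real// divr_ge0 ?exprn_ge0// ltW.
rewrite (CrealP qR) normf_div (gtr0_norm yy0) expr_div_n.
have -> : `|dot x y| ^+ 2 / dot y y ^+ 2 * dot y y = `|dot x y| ^+ 2 / dot y y.
  by rewrite expr2 invfM mulrA divfK ?gt_eqF.
set q := _ / _ => le_q.
rewrite -[leLHS](divfK (lt0r_neq0 yy0)) -/q ler_pM2r// mulrBl mul1r.
by rewrite lerBrDr -lerBrDl; apply: le_trans le_q _; rewrite opprD addrA addrK.
Qed.

(** Stated for plain sets, since the induction replaces [F] by the set [addline F u]. *)
Definition subspace {K : pzRingType} {U : lmodType K} (G : set U) :=
  G 0 /\ forall a u v, G u -> G v -> G (a *: u + v).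

Section Subspace.
Context {K : pzRingType} {U : lmodType K} {G : set U}.
Hypothesis sG : subspace G.

Lemma subspaceZ a u : G u -> G (a *: u).
Proof. by move=> Gu; rewrite -[_ *: _]addr0; apply: sG.2 => //; exact: sG.1. Qed.

Lemma subspaceB u v : G u -> G v -> G (u - v).
Proof. by move=> *; rewrite -scaleN1r addrC; apply: sG.2. Qed.

End Subspace.

Definition addline {K : pzRingType} {U : lmodType K} (G : set U) (v : U) :=
  [set a *: v + y | a in [set: K] & y in G].

Lemma subspace_addline {K : pzRingType} {U : lmodType K} {G : set U} (v : U) :
  subspace G -> subspace (addline G v).
Proof.
move=> sG; split.
  by exists 0 => //; exists 0; [exact: sG.1|rewrite scale0r addr0].
move=> a _ _ [b _ [y Gy <-]] [c _ [z Gz <-]].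
exists (a * b + c) => //; exists (a *: y + z); first exact: sG.2.
by rewrite scalerDl scalerDr scalerA addrACA.
Qed.

(** The radius of a ball around [v] that misses [G] serves as [d]: for nonzero [a], divide by [a]
    and compare [v] with [- a^-1 *: y], which lies in [G]. *)
Lemma dist_notin_closed {K : numFieldType} {U : normedModType K} {G : set U}
    {v : U} :
  closed G -> subspace G -> ~ G v ->
  exists2 d : K, 0 < d & forall a y, G y -> d * `|a| <= `|a *: v + y|.
Proof.
move=> cG sG Gv; have : open (~` G) by rewrite openC.
rewrite openE => /(_ _ Gv) /nbhs_ballP[e /= e0 ve].
exists e => // a y Gy; have [->|a0] := eqVneq a 0; first by rewrite normr0 mulr0.
have -> : a *: v + y = a *: (v - - a^-1 *: y).
  by rewrite scaleNr opprK scalerDr scalerA mulfV// scale1r.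
rewrite normrZ mulrC ler_pM2l ?normr_gt0// real_leNgt ?normr_real ?gtr0_real//.
apply/negP => lt_e; apply: (ve (- a^-1 *: y)); last exact: subspaceZ.
by rewrite -ball_normE.
Qed.

Section ClosedAddline.
Context {C : numClosedFieldType} {H : completeNormedModType C}.
Variable dot : {dot H for (Num.conj : C -> C)}.
Hypothesis norm_dot : forall x : H, `|x| = sqrtC (dot x x).

Let normsq (x : H) : `|x| ^+ 2 = dot x x.
Proof. by rewrite norm_dot sqrtCK. Qed.

Lemma cauchy_schwarz (x y : H) : `|dot x y| <= `|x| * `|y|.
Proof.
have : `|dot x y| ^+ 2 <= (1 - 0) * dot x x * dot y y.
  by apply: dot_le_of_dist => t; rewrite mul0r dnorm_ge0.
by rewrite subr0 mul1r -!normsq -exprMn ler_sqr ?nnegrE ?mulr_ge0.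
Qed.

(* [C] is not assumed complete, so limits are taken in [H]; a limit of
   multiples of [v] is again one because [w = (w, v) / (v, v) v] is a closed
   condition on [w]. *)
Lemma closed_addline (F : set H) (v : H) :
  closed F -> subspace F -> closed (addline F v).
Proof.
move=> cF sF.
have [Fv|Fv] := pselect (F v).
  suff -> : addline F v = F by [].
  apply/seteqP; split=> [_ [a _ [y Fy <-]]|y Fy]; first exact: sF.2.
  by exists 0 => //; exists y; rewrite ?scale0r ?add0r.
have v0 : 0 < `|v|.
  by rewrite normr_gt0; apply: contra_notN Fv => /eqP ->; exact: sF.1.
have [d d0 dF] := dist_notin_closed cF sF Fv.
(* [k g] is the coefficient of [g] along [v], arbitrary off [addline F v]. The next bound makes
   [g |-> k g *: v] Lipschitz on [addline F v]. *)
have /choice[k kP] : forall g, exists a, addline F v g -> F (g - a *: v).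
  move=> g; have [[a _ [y Fy <-]]|nG] := pselect (addline F v g).
    by exists a => _; rewrite addrAC subrr add0r.
  by exists 0 => /nG.
have kB g h : addline F v g -> addline F v h ->
    `|k g *: v - k h *: v| <= `|g - h| * (`|v| / d).
  move=> /kP Fg /kP Fh.
  have := dF (k g - k h) _ (subspaceB sF _ _ Fg Fh).
  rewrite scalerBl opprB addrACA (addrC (k g *: v)) subrK addKr.
  by rewrite -scalerBl normrZ mulrA mulrAC ler_pM2r// ler_pdivlMr// mulrC.
move=> z Gz.
pose P := within (addline F v) (nbhs z).
have PP : ProperFilter P by exact: within_nbhs_proper.
have vd0 : 0 < `|v| / d by rewrite divr_gt0.
have : cauchy ((fun g => k g *: v) @ P).
  apply: cauchy_exP => e e0.
  (* Two points of a ball are less than two radii apart, hence the half; the other divisor is the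
     Lipschitz constant. *)
  have e20 : 0 < e / (`|v| / d) / 2 by rewrite !divr_gt0.
  have [h [Gh zh]] := Gz _ (nbhsx_ballx z _ e20).
  exists (k h *: v); rewrite /P /within /=.
  apply: filterS (nbhsx_ballx z _ e20) => g zg Gg /=.
  rewrite -ball_normE /=; apply: le_lt_trans (kB _ _ Gh Gg) _.
  rewrite -ltr_pdivlMr//; have := ball_splitr zh zg.
  by rewrite -ball_normE.
move=> /cauchy_cvg/cvg_ex[w kw].
have wv e : 0 < e ->
    exists g, [/\ addline F v g, `|w - k g *: v| < e & `|z - g| < e].
  move=> e0.
  have Pw : P (fun g => `|w - k g *: v| < e).
    by move/cvgrPdist_lt: kw => /(_ e e0).
  have Pz : P (fun g => `|z - g| < e).
    by apply: filterS (nbhsx_ballx z e e0) => g; rewrite -ball_normE.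
  have PG : P (addline F v) by exact: withinT.
  have [g [[? ?] ?]] := filter_ex (filterI (filterI Pw Pz) PG).
  by exists g.
(* Projection onto [v] fixes [k g *: v], so the residual of [w] is that of [w - k g *: v], whose two
   terms are at most [e / 2] each. *)
have wE : w = (dot w v / dot v v) *: v.
  have vv0 : 0 < dot v v by rewrite -normsq exprn_gt0.
  apply/eqP; rewrite -subr_eq0 -normr_le0; apply/ler_addgt0Pl => e e0.
  rewrite addr0.
  have [g [_ wg _]] := wv _ (divr_gt0 e0 (ltr0n _ 2)).
  have -> : w - (dot w v / dot v v) *: v =
      (w - k g *: v) - (dot (w - k g *: v) v / dot v v) *: v.
    rewrite linearBl/= linearZl_LR/= mulrBl mulfK ?gt_eqF//.
    by rewrite scalerBl opprB addrA subrK.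
  apply: le_trans (ler_normB _ _) _; rewrite [e]splitr lerD ?(ltW wg)//.
  rewrite normrZ normf_div (gtr0_norm vv0) -normsq.
  apply: le_trans (ltW wg).
  rewrite mulrAC ler_pdivrMr ?exprn_gt0// expr2 mulrA ler_pM2r//.
  exact: cauchy_schwarz.
(* [z - w] is a limit of the points [g - k g *: v] of the closed set [F]. *)
exists (dot w v / dot v v) => //; exists (z - w); last by rewrite -wE addrC subrK.
apply: cF => B /nbhs_ballP[e /= e0 eB].
have [g [Gg wg zg]] := wv _ (divr_gt0 e0 (ltr0n _ 2)).
exists (g - k g *: v); split; first exact: kP.
apply: eB; rewrite -ball_normE/=.
have -> : z - w - (g - k g *: v) = (z - g) - (w - k g *: v).
  by rewrite !opprB addrACA (addrC (- w)) addrACA (addrC (k g *: v)) addrACA.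
by apply: le_lt_trans (ler_normB _ _) _; rewrite [e]splitr ltrD.
Qed.

End ClosedAddline.

Section Span.
Context {K : pzRingType} {U : lmodType K}.

Definition lspan {n} (v : 'I_n -> U) :=
  [set x | exists c : 'I_n -> K, x = \sum_(i < n) c i *: v i].

Lemma lspan_recl n (v : 'I_n.+1 -> U) :
  lspan v = addline (lspan (v \o lift ord0)) (v ord0).
Proof.
apply/seteqP; split=> [_ [c ->]|_ [a _ [_ [c ->] <-]]].
  rewrite big_ord_recl; exists (c ord0) => //.
  exists (\sum_(i < n) c (lift ord0 i) *: v (lift ord0 i)) => //.
  by exists (c \o lift ord0).
exists (fun i => oapp c a (unlift ord0 i)).
rewrite big_ord_recl unlift_none; congr (_ + _).
by apply: eq_bigr => i _; rewrite liftK.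
Qed.

Lemma subspace_lspan n (v : 'I_n -> U) : subspace (lspan v).
Proof.
split; first by exists (fun=> 0); rewrite big1// => i _; rewrite scale0r.
move=> a _ _ [c ->] [d ->]; exists (fun i => a * c i + d i).
rewrite scaler_sumr -big_split; apply: eq_bigr => i _ /=.
by rewrite scalerDl scalerA.
Qed.

End Span.

Lemma transversal_bound {C : numClosedFieldType} {H : completeNormedModType C}
    (dot : {dot H for (Num.conj : C -> C)})
    (norm_dot : forall x : H, `|x| = sqrtC (dot x x))
    n (v : 'I_n -> H) (F : set H) :
  closed F -> subspace F -> F `&` lspan v `<=` [set 0] ->
  exists2 M : C, 0 < M &
    forall x y, lspan v x -> F y -> `|x| <= M * `|x + y|.
Proof.
elim: n => [|n IH] in v F *.
  move=> _ _ _; exists 1 => // x y [c ->] _.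
  by rewrite big_ord0 normr0 mul1r.
rewrite lspan_recl; set u := v ord0; set W := lspan _ => cF sF FV.
have sW : subspace W by exact: subspace_lspan.
(* A redundant generator is dropped and [F] is kept; otherwise [u] is moved to [F]. *)
have [Wu|Wu] := pselect (W u).
  have VW : addline W u = W.
    apply/seteqP; split=> [_ [a _ [w Ww <-]]|w Ww]; first exact: sW.2.
    by exists 0 => //; exists w; rewrite ?scale0r ?add0r.
  by rewrite VW in FV *; exact: IH.
have Vu : addline W u u.
  by exists 1 => //; exists 0; [exact: sW.1|rewrite scale1r addr0].
have Fu : ~ F u.
  by move=> Fu; apply: Wu; rewrite (FV u (conj Fu Vu)); exact: sW.1.
have [d d0 dF] := dist_notin_closed cF sF Fu.
(* If [a *: u + y] is in [W], then [y] is in both [F] and [addline W u], so it vanishes; then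
   [a *: u] is in [W], which forces [a = 0]. *)
have FW : addline F u `&` W `<=` [set 0].
  move=> _ [[a _ [y Fy <-]] Ww].
  have y0 : y = 0.
    apply: FV; split=> //; exists (- a) => //; exists (a *: u + y) => //.
    by rewrite scaleNr addKr.
  move: Ww; rewrite y0 addr0 => Wau; have [->|a0] := eqVneq a 0.
    by rewrite scale0r.
  case: Wu; rewrite -[u]scale1r -(mulVf a0) -scalerA; exact: subspaceZ.
have [M M0 MF] := IH _ _ (closed_addline dot norm_dot F u cF sF)
  (subspace_addline u sF) FW.
(* Let [s = a *: u + w + y]. Induction gives [|w| <= M * |s|], so
   [d * |a| <= |a *: u + y| <= (1 + M) * |s|]; the two summands bound [a *: u] and [w]. *)
exists ((1 + M) / d * `|u| + M).
  by rewrite ltr_wpDl// mulr_ge0// divr_ge0 ?addr_ge0// ltW.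
move=> _ y [a _ [w Ww <-]] Fy.
have w_le : `|w| <= M * `|a *: u + w + y|.
  by rewrite addrAC addrC; apply: MF => //; exists a => //; exists y.
rewrite mulrDl; apply: le_trans (ler_normD _ _) _; apply: lerD => //.
rewrite normrZ mulrAC ler_wpM2r// mulrAC ler_pdivlMr// mulrC.
apply: le_trans (dF _ _ Fy) _.
have -> : a *: u + y = (a *: u + w + y) - w by rewrite addrAC addrK.
by apply: le_trans (ler_normB _ _) _; rewrite mulrDl mul1r lerD2l.
Qed.

Theorem theorem3p1 (R : realType) (H : completeNormedModType R[i])
    (dot : {dot H for (Num.conj : R[i] -> R[i])})
    (norm_dot : forall x : H, `|x| = sqrtC (dot x x))
    (F : submodClosed H) (F_closed : closed [set` F])
    (V : submodClosed H) (V_fin : finite_dimensional V)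
    (FV : [set` F] `&` [set` V] = [set 0]) :
  exists gamma : R, 0 <= gamma < 1 /\
    forall x y : H, x \in V -> y \in F ->
      `|dot x y| <= gamma%:C * `|x| * `|y|.
Proof.
have normsq (x : H) : `|x| ^+ 2 = dot x x by rewrite norm_dot sqrtCK.
have sF : subspace [set` F].
  by split=> [|a u v /= Fu Fv]; rewrite /= ?rpred0 ?rpredD ?rpredZ.
have [n [v Vv]] := V_fin.
have VE : [set` V] = lspan v by apply/seteqP; split=> x /Vv.
have [M M0 MF] : exists2 M : R[i], 0 < M &
    forall x y, lspan v x -> [set` F] y -> `|x| <= M * `|x + y|.
  by apply: (transversal_bound dot norm_dot); rewrite // -VE FV.
(* Positivity in [R[i]] includes a zero imaginary part. *)
have [r r0 Mr] : exists2 r : R, 0 < r & M = r%:C.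
  by case: M M0 {MF} => a b; rewrite ltcE /= => /andP[/eqP-> a0]; exists a.
(* Enlarging [r] to [1 + r] ensures [c <= 1], so that [1 - c] is the square of its root; [0 < c]
   gives [gamma < 1]. *)
pose c : R := (1 + r) ^- 2.
have c01 : 0 < c <= 1.
  rewrite /c invr_gt0 exprn_gt0 ?addr_gt0//= invf_le1 ?exprn_gt0 ?addr_gt0//.
  by rewrite exprn_ege1// lerDl ltW.
have [c0 c1] := andP c01.
exists (Num.sqrt (1 - c)); split.
  by rewrite sqrtr_ge0 -[ltRHS]sqrtr1 ltr_sqrt// ltrBlDr ltrDl.
move=> x y Vx Fy.
have g0 : 0 <= (Num.sqrt (1 - c))%:C by rewrite ler0c sqrtr_ge0.
have gsq : (Num.sqrt (1 - c))%:C ^+ 2 = 1 - c%:C.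
  by rewrite -rmorphXn/= sqr_sqrtr ?subr_ge0// rmorphB rmorph1.
rewrite -ler_sqr ?nnegrE ?mulr_ge0// !exprMn gsq !normsq.
have r1 : 0 < (1 + r)%:C by rewrite ltcR addr_gt0.
apply: dot_le_of_dist => t; rewrite -!normsq fmorphV rmorphXn/= mulrC.
rewrite ler_pdivrMr ?exprn_gt0// mulrC -exprMn.
rewrite ler_sqr ?nnegrE ?mulr_ge0 ?(ltW r1)//.
apply: le_trans (MF _ (t *: y) _ _) _; first by rewrite -VE.
  exact: subspaceZ.
by rewrite Mr ler_wpM2r// lecR lerDr.
Qed.
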